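(* For every positive integer $n$ and every parking content $b\in\mathrm{PF}_\le(n)$, \[\sum_{w\in\mathfrak S_n}t^{\mathrm{exced}(\pi^{b,w})}=\sum_{w\in\mathfrak S_n}t^{\mathrm{des}(\sigma^{b,w})}.\]
   Context: A parking function of length $n$ is a sequence $\pi=(\pi_1,\dots,\pi_n)$ of positive integers whose weakly increasing rearrangement $c_1\le\dots\le c_n$ satisfies $c_j\le j$ for all $j$. A parking content is a sequence $b=(b_1,\dots,b_n)$ of positive integers with $b_1\le\dots\le b_n$ and $b_j\le j$ for all $j$; $\mathrm{PF}_\le(n)$ is the set of these. For $b\in\mathrm{PF}_\le(n)$ and $w\in\mathfrak S_n$, define $\pi^{b,w}$ by $\pi^{b,w}_i=b_{w(i)}$. Parking procedure: cars $1,\dots,n$ arrive in order at spots $1,\dots,n$; car $i$ goes to spot $\pi_i$ and, if it is occupied, moves forward to the next unoccupied spot. The parking outcome $\mathrm{oc}(\pi)\in\mathfrak S_n$ is the permutation $\sigma$ where car $i$ parks in spot $\sigma(i)$. Set $\sigma^{b,w}=\mathrm{oc}(\pi^{b,w})$. $\mathrm{exced}(\pi)=|\{i\in[n]:\pi_i>i\}|$, and for a permutation $w$, $\mathrm{des}(w)=|\{i\in[n-1]:w(i)>w(i+1)\}|$. *)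

(* Defs.v *)
From mathcomp Require Import all_boot all_order all_fingroup all_algebra.
From mathcomp Require Import zify.
Set Implicit Arguments.
Unset Strict Implicit.
Unset Printing Implicit Defensive.
Import GRing.Theory.

(* Preferences and spots are natural numbers 1, ..., n, as on paper.  Cars are *)
(* indexed by 'I_n, so that i : 'I_n stands for car i.+1, and a permutation    *)
(* s : 'S_n stands for the permutation of {1, ..., n} mapping i.+1 to (s i).+1. *)

Definition parking_content n (b : n.-tuple nat) : bool :=
  sorted leq b && [forall i : 'I_n, 0 < tnth b i <= i.+1].

Definition parking_function n (p : n.-tuple nat) : bool :=
  parking_content [tuple of sort leq p].

Definition rearrange n (b : n.-tuple nat) (w : 'S_n) : n.-tuple nat :=
  [tuple tnth b (w i) | i < n].

Definition next_free n (occ : seq nat) (p : nat) : option nat :=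
  ohead [seq s <- iota 1 n | (p <= s) && (s \notin occ)].

(* The state is the sequence of the spots taken so far, in order of arrival of *)
(* the cars; it is None once some car has failed to park.                      *)
Definition park_car n (st : option (seq nat)) (p : nat) : option (seq nat) :=
  if st is Some occ then omap (rcons occ) (next_free n occ p) else None.

Definition park n (prefs : seq nat) : option (seq nat) :=
  foldl (park_car n) (Some [::]) prefs.

(* The default value 1 is never used on parking functions, see outcomeP.       *)
Definition outcome n (p : n.-tuple nat) : 'S_n :=
  odflt 1%g
    [pick s : 'S_n | park n p == Some [seq (s i : nat).+1 | i <- enum 'I_n]].

Definition exced n (p : n.-tuple nat) : nat :=
  #|[set i : 'I_n | i.+1 < tnth p i]|.

Definition des n (w : 'S_n) : nat :=
  #|[set i : 'I_n | [exists j : 'I_n, (j == i.+1 :> nat) && (w j < w i)]]|.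

Lemma rearrange_parking_function n (b : n.-tuple nat) (w : 'S_n) :
  parking_content b -> parking_function (rearrange b w).
Proof.
move=> bP; rewrite /parking_function.
suff -> : [tuple of sort leq (rearrange b w)] = b by [].
apply/val_inj => /=; case/andP: bP => sb _.
rewrite -[RHS](sorted_sort leq_trans sb).
apply/perm_sortP; [exact: leq_total | exact: leq_trans | exact: anti_leq |].
by apply/tuple_permP; exists w.
Qed.

Lemma parking_function_count n (p : n.-tuple nat) s :
  parking_function p -> s <= n -> count (ltn s) p <= n - s.
Proof.
case/andP=> _ /forallP pP sn.
have -> : count (ltn s) p = count (ltn s) (sort leq p).
  by apply/seq.permP; rewrite perm_sym perm_sort.
set c := sort leq p.
have szc : size c = n by rewrite size_sort size_tuple.
rewrite -(cat_take_drop s c) count_cat.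
have -> : count (ltn s) (take s c) = 0.
  apply/eqP; rewrite -leqn0 leqNgt -has_count; apply/hasPn => x.
  case/(nthP 0) => i; rewrite size_take_min szc => ilt <-.
  have i_n : i < n by lia.
  rewrite nth_take; last by lia.
  have := pP (Ordinal i_n); rewrite (tnth_nth 0) /= -/c => /andP[_ ?].
  by rewrite -leqNgt; lia.
by rewrite add0n (leq_trans (count_size _ _)) // size_drop szc.
Qed.

Lemma parking_function_gt0 n (p : n.-tuple nat) x :
  parking_function p -> x \in (p : seq nat) -> 0 < x.
Proof.
case/andP=> _ /forallP pP; rewrite -(mem_sort leq).
case/(nthP 0) => i; rewrite size_sort size_tuple => i_n <-.
by have := pP (Ordinal i_n); rewrite (tnth_nth 0) /= => /andP[].
Qed.

Lemma park_prefix n (p : n.-tuple nat) (r q : seq nat) :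
  parking_function p -> p = r ++ q :> seq nat ->
  exists occ, [/\ park n r = Some occ, size occ = size r, uniq occ,
    {subset occ <= iota 1 n} &
    forall s, s \notin occ -> count (ltn s) occ <= count (ltn s) r].
Proof.
move=> pP; elim/last_ind: r q => [|r x IH] q pE.
  by exists [::]; split.
have [|occ [parkE szE uocc subocc cocc]] := IH (x :: q).
  by rewrite pE cat_rcons.
have x_gt0 : 0 < x.
  apply: (parking_function_gt0 pP).
  by rewrite pE mem_cat mem_rcons inE eqxx.
have occ0 : 0 \notin occ by apply/negP => /subocc; rewrite mem_iota.
rewrite {1}/park -cats1 foldl_cat -/(park n r) parkE /= /next_free.
case E: [seq s <- iota 1 n | (x <= s) && (s \notin occ)] => [|y l].
  have full s : x <= s -> 0 < s <= n -> s \in occ.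
    move=> xs sn; apply/negPn/negP => nocc.
    have : s \in [seq s <- iota 1 n | (x <= s) && (s \notin occ)].
      by rewrite mem_filter xs nocc mem_iota; lia.
    by rewrite E.
  have ex0 : exists s, (s <= n) && (s \notin occ) by exists 0.
  have ub s : (s <= n) && (s \notin occ) -> s <= n by case/andP.
  case: (ex_maxnP ex0 ub) => s /andP[sn nocc] smax.
  have sx : s < x.
    rewrite ltnNge; apply/negP => xs.
    by move/negP: nocc; apply; apply: full; lia.
  have le1 : n - s <= count (ltn s) occ.
    rewrite -size_filter -{1}(size_iota s.+1 (n - s)).
    apply: uniq_leq_size (iota_uniq _ _) _ => t.
    rewrite mem_iota mem_filter => /andP[st tn]; apply/andP; split=> //.
    apply/negPn/negP => ntocc.
    have : t <= s by apply: smax; rewrite ntocc andbT; lia.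
    by lia.
  have := parking_function_count pP sn; rewrite pE -cats1 !count_cat /= sx.
  by have := cocc _ nocc; lia.
have : y \in [seq s <- iota 1 n | (x <= s) && (s \notin occ)].
  by rewrite E inE eqxx.
rewrite mem_filter => /andP[/andP[xy yocc] yn].
have ymin s : x <= s -> s < y -> s \in occ.
  move=> xs sy; apply/negPn/negP => nocc.
  have : s \in [seq s <- iota 1 n | (x <= s) && (s \notin occ)].
    by rewrite mem_filter xs nocc; move: yn; rewrite !mem_iota; lia.
  have : sorted ltn (y :: l).
    by rewrite -E sorted_filter ?iota_ltn_sorted //; exact: ltn_trans.
  rewrite E inE /= (path_sortedE ltn_trans) => /andP[/allP H _].
  by case/orP => [/eqP|/H /=]; lia.
exists (rcons occ y); split => //.
- by rewrite cats1 !size_rcons szE.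
- by rewrite rcons_uniq yocc.
- by move=> s; rewrite mem_rcons inE => /orP[/eqP->|/subocc].
move=> s; rewrite mem_rcons inE negb_or => /andP[sy socc].
rewrite -!cats1 !count_cat /= !addn0 leq_add ?cocc //.
case: (ltnP s x) => [_|xs]; first by case: (s < y).
case: (ltnP s y) => // s_y.
by rewrite (ymin _ xs s_y) in socc.
Qed.

Lemma outcomeP n (p : n.-tuple nat) :
  parking_function p ->
  park n p = Some [seq (outcome p i : nat).+1 | i <- enum 'I_n].
Proof.
move=> pP; rewrite /outcome; case: pickP => [s /eqP //|none].
have [|occ [parkE szE uocc subocc _]] := @park_prefix n p p [::] pP.
  by rewrite cats0.
rewrite size_tuple in szE.
have lt_occ (i : 'I_n) : (nth 0 occ i).-1 < n.
  have /subocc : nth 0 occ i \in occ by rewrite mem_nth // szE.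
  by rewrite mem_iota; lia.
have gt_occ (i : 'I_n) : 0 < nth 0 occ i.
  have /subocc : nth 0 occ i \in occ by rewrite mem_nth // szE.
  by rewrite mem_iota; lia.
have inj : injective (fun i => Ordinal (lt_occ i)).
  move=> i j /(congr1 val) /= ij; apply/val_inj/eqP => /=.
  rewrite -(nth_uniq 0 _ _ uocc) ?szE //.
  by rewrite -(prednK (gt_occ i)) ij prednK.
have /eqP[] := none (perm inj).
rewrite parkE; congr Some; apply: (@eq_from_nth _ 0).
  by rewrite size_map size_enum_ord.
move=> i; rewrite szE => i_n.
rewrite (nth_map (Ordinal i_n)) ?size_enum_ord // permE /=.
by rewrite nth_enum_ord // prednK // (gt_occ (Ordinal i_n)).
Qed.

(* Main.v *)
(* Induction on n, removing the last and largest entry q + 1 of b.  Inserting  *)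

(* Both sums obey the recursion isolated in [sum_insertions]. The lemmas [exced_insert] and
   [des_insert] supply it for the two statistics, each with its own bijection inserting the largest
   entry of [b] into a shorter permutation. Outcomes are handled through [parks], which determines
   them ([outcome_parks]) and survives an insertion ([parks_lift]). *)
(* a car of preference q + 1 into a permutation of the remaining preferences   *)
(* can be done in n + 1 ways.  On either side, the value d of the statistic    *)
(* becomes d + 1 for q - d of them and stays d for the others, so both sides   *)
(* obey the same recursion.  For exced, the new car replaces an old one, which *)
(* is moved to the end: exactly the positions <= q that were not excedances    *)
(* become so.  For des, the new car goes to a gap of the old arrival order.    *)
(* No preference exceeds q + 1, so the spots > q are filled in order of        *)
(* arrival, and the new outcome only inserts one letter > q, keeping the       *)
(* letters > q increasing: a descent is created exactly when the next letter   *)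
(* is <= q and the gap was not a descent.                                      *)
Require Import Defs.
From mathcomp Require Import all_boot all_order all_fingroup all_algebra.
From mathcomp Require Import zify.
Set Implicit Arguments.
Unset Strict Implicit.
Unset Printing Implicit Defensive.
Import GRing.Theory.
Local Open Scope ring_scope.

(* Car i takes the first spot from its preference on that no earlier car has.  *)
Definition parks n (p : n.-tuple nat) (s : 'S_n) : Prop :=
  forall i, (tnth p i <= (s i).+1)%N /\
    forall j, (tnth p i <= (s j).+1)%N -> (s j < s i)%N -> (j < i)%N.

(** * Characterization of the outcome *)

Lemma next_free_first n occ p t :
  (0 < t <= n)%N -> (p <= t)%N -> t \notin occ ->
  (forall s, (0 < s < t)%N -> (p <= s)%N -> s \in occ) ->
  next_free n occ p = Some t.
Proof.
move=> tn pt tocc full; rewrite /next_free.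
have -> : iota 1 n = iota 1 t.-1 ++ t :: iota t.+1 (n - t).
  have -> : n = (t.-1 + (n - t).+1)%N by lia.
  rewrite iotaD /=; congr (_ ++ _ :: iota _ _); lia.
rewrite filter_cat (_ : [seq s <- iota 1 t.-1 | _] = [::]) /= ?pt ?tocc //.
apply/eqP; rewrite -(negbK (_ == _)) -has_filter; apply/hasPn => s.
rewrite mem_iota => sE; rewrite negb_and negbK; case: leqP => //= ps.
by apply: full => //; lia.
Qed.

(** Once the first m cars stand as [s] says, every spot from the next preference up to just before
    the spot given by [s] is taken, so the procedure sends the next car there. *)
Lemma outcome_parks n (p : n.-tuple nat) (s : 'S_n) :
  parks p s -> outcome p = s.
Proof.
move=> sP.
set c := [seq (s i : nat).+1 | i <- enum 'I_n].
have szc : size c = n by rewrite size_map size_enum_ord.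
have cE (i : 'I_n) : nth 0 c i = (s i).+1.
  by rewrite (nth_map i) ?size_enum_ord // nth_ord_enum.
have takeP m : (m <= n)%N -> park n (take m p) = Some (take m c).
  elim: m => [|m IH] mn; first by rewrite !take0.
  rewrite (take_nth 0) ?size_tuple // (take_nth 0) ?szc //.
  rewrite /park -cats1 foldl_cat -/(park n _) IH 1?ltnW //=.
  pose i := Ordinal mn; have [pi firsti] := sP i.
  rewrite -[m]/(i : nat) -tnth_nth cE.
  rewrite (@next_free_first _ _ _ (s i).+1) //=.
  - apply/negP => /(nthP 0)[j]; rewrite size_take szc mn => jm.
    rewrite nth_take // (cE (Ordinal (ltn_trans jm mn))) => /succn_inj.
    by move=> /val_inj/perm_inj/(congr1 val) /= ji; lia.
  - move=> t tn pt; have tn1 : (t.-1 < n)%N by have := ltn_ord (s i); lia.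
    have [j jE] : exists j, s j = Ordinal tn1.
      by exists (s^-1%g (Ordinal tn1)); rewrite permKV.
    have tE : t = (s j).+1 by rewrite jE /=; lia.
    have jm : (j < m)%N by apply: (firsti j); lia.
    apply/(nthP 0); exists j; first by rewrite size_take szc mn.
    by rewrite nth_take // cE tE.
have parkE : park n p = Some c.
  by rewrite -(take_size (tval p)) size_tuple takeP // -szc take_size.
rewrite /outcome parkE; case: pickP => [s' /eqP[cs']|/(_ s)/eqP[]//].
apply/permP => i; apply/val_inj/succn_inj; rewrite /= -[RHS]cE cs'.
by rewrite (nth_map i) ?size_enum_ord // nth_ord_enum.
Qed.

(** * Inserting a car into an outcome *)

Definition descent n (s : 'S_n) (i : 'I_n) : bool :=
  [exists j : 'I_n, (j == i.+1 :> nat) && (s j < s i)%N].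

Section Insertion.

Variables (n q : nat) (p : n.-tuple nat) (s : 'S_n).
Hypotheses (qn : (q <= n)%N) (sP : parks p s).
Hypothesis p_le : forall i, (tnth p i <= q.+1)%N.

(** Car j, with preference at most q + 1, passed the spot of car i and so found it taken. *)
Lemma parks_increasing i j : (q <= s i)%N -> (s i < s j)%N -> (i < j)%N.
Proof.
by move=> qi ij; apply: (sP j).2 => //; apply: leq_trans (p_le j) _.
Qed.

Variable k : 'I_n.+1.

(** Here [v] is where a car of preference q + 1 parks after the first k old cars: the least t >= q
    that they leave free. By [parks_increasing], old cars beyond it come later still. *)
Lemma insertion_spot : exists v : 'I_n.+1, (q <= v)%N /\
  forall i, (q <= s i)%N -> (s i < v)%N = (i < k)%N.
Proof.
pose P t := (q <= t)%N && [forall i, (s i == t :> nat) ==> (k <= i)%N].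
have Pn : P n.
  rewrite /P qn; apply/forallP => i; apply/implyP => /eqP E.
  by have := ltn_ord (s i); lia.
have exP : exists t, P t by exists n.
case: (ex_minnP exP) => v /andP[qv /forallP vP] vmin.
have vn : (v < n.+1)%N by rewrite ltnS vmin.
exists (Ordinal vn); split=> // i qi /=.
case: ltnP => [siv|vsi].
  have : ~~ P (s i) by apply/negP => /vmin; lia.
  rewrite /P qi negb_forall => /existsP[j].
  rewrite negb_imply => /andP[/eqP/val_inj/perm_inj -> ]; lia.
have v_lt : (v < n)%N by apply: leq_ltn_trans vsi _.
pose j := s^-1%g (Ordinal v_lt).
have sj : s j = v :> nat by rewrite permKV.
have kj : (k <= j)%N by have /implyP := vP j; apply; apply/eqP.
have [E|ne] := eqVneq (s i) (s j); first by rewrite (perm_inj E); lia.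
have : (j < i)%N.
  apply: parks_increasing; first by lia.
  by move: ne; rewrite -val_eqE /=; lia.
lia.
Qed.

Variable v : 'I_n.+1.
Hypotheses (qv : (q <= v)%N).
Hypothesis vP : forall i, (q <= s i)%N -> (s i < v)%N = (i < k)%N.

Lemma descent_lift_id :
  descent (lift_perm k v s) k =
    [exists j : 'I_n, (j == k :> nat) && (s j < q)%N].
Proof.
apply/existsP/existsP => -[j /andP[/eqP jk]].
  case: (unliftP k j) jk => [j'|] -> /=; last by lia.
  rewrite lift_perm_lift lift_perm_id /= /bump => ? ?.
  by exists j'; have := @vP j'; lia.
move=> sj; exists (lift k j); rewrite lift_perm_lift lift_perm_id /= /bump; lia.
Qed.

Lemma descent_lift (i : 'I_n) :
  descent (lift_perm k v s) (lift k i) = descent s i && (i.+1 != k).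
Proof.
apply/existsP/andP => [[j /andP[/eqP ji]]|[/existsP[j /andP[/eqP ji]]]].
  rewrite lift_perm_lift; case: (unliftP k j) ji => [j'|] -> /=; last first.
    by rewrite lift_perm_id /bump; have := @vP i; lia.
  rewrite lift_perm_lift /= /bump => ? ?; split; last by lia.
  by apply/existsP; exists j'; lia.
move=> sj /eqP ik; exists (lift k j); rewrite !lift_perm_lift /= /bump.
apply/andP; split; last by lia.
by rewrite ji; apply/eqP; case: leqP; case: leqP; lia.
Qed.

(** The gap after car i is [lift ord0 i], the gap before car j is [lift ord_max j]. The left set
    holds the gaps that break an old descent, the right set those where the new car starts a
    descent. *)
Lemma des_lift :
  (des (lift_perm k v s) + (k \in [set lift ord0 i | i in descent s]) =
   des s + (k \in [set lift ord_max j | j in [set j : 'I_n | (s j < q)%N]]))%N.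
Proof.
have desE m (w : 'S_m) : des w = (\sum_i descent w i)%N.
  by rewrite /des cardsE -sum1_card big_mkcond.
rewrite !desE (bigD1_ord k) //= descent_lift_id.
under eq_bigr do rewrite descent_lift.
have -> : [exists j : 'I_n, (j == k :> nat) && (s j < q)%N] =
    (k \in [set lift ord_max j | j in [set j : 'I_n | (s j < q)%N]]).
  apply/existsP/imsetP => [[j /andP[/eqP jk sj]]|[j]].
    by exists j; rewrite ?inE //; apply/ord_inj; rewrite lift_max.
  by rewrite inE => sj ->; exists j; rewrite sj lift_max eqxx.
rewrite [RHS]addnC -addnA; congr addn.
case: imsetP => [[i di ki]|nk].
  have {}di : descent s i by [].
  rewrite (bigD1 i) //= [RHS](bigD1 i) //= di ki lift0 eqxx andbF add0n addn1.
  rewrite (eq_bigr (fun j => nat_of_bool (descent s j))) => [|j ji]; last first.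
    by rewrite eqSS ji andbT.
  by rewrite add1n.
rewrite addn0; apply: eq_bigr => i _.
case di: (descent s i) => //=; case: eqP => // ik.
by case: nk; exists i => //; apply/val_inj; rewrite /= -ik.
Qed.

Variable p' : n.+1.-tuple nat.
Hypothesis p'k : tnth p' k = q.+1.
Hypothesis p'lift : forall i, tnth p' (lift k i) = tnth p i.

(** An old car shifted by one spot has [v <= s i], hence arrives after the new car and finds its
    spot taken. *)
Lemma parks_lift : parks p' (lift_perm k v s).
Proof.
move=> i; case: (unliftP k i) => [i'|] -> {i}; last first.
  rewrite p'k lift_perm_id; split=> [|j]; first by lia.
  case: (unliftP k j) => [j'|] ->; rewrite ?lift_perm_id ?ltnn //.
  rewrite lift_perm_lift /= /bump => ? ?.
  by have := @vP j'; lia.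
rewrite p'lift lift_perm_lift; have [pi firsti] := sP i'; have := p_le i'.
split=> [|j]; first by rewrite /= /bump; lia.
case: (unliftP k j) => [j'|] ->; last first.
  by rewrite lift_perm_id /= /bump; have := @vP i'; lia.
by rewrite lift_perm_lift /= /bump; have := firsti j'; lia.
Qed.

End Insertion.

(** * Counting the insertions *)

(** The statistic is d + 1 exactly on [B :\: A], which has q - d elements, and d elsewhere. *)
Lemma sum_insertions (V : nmodType) (F : nat -> V) n q d
    (A B : {set 'I_n.+1}) (stat : 'I_n.+1 -> nat) :
  A \subset B -> #|A| = d -> #|B| = q ->
  (forall k, stat k + (k \in A) = d + (k \in B))%N ->
  \sum_k F (stat k) = F d.+1 *+ (q - d) + F d *+ (n.+1 - (q - d)).
Proof.
move=> AB cA cB statE.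
have cD : #|B :\: A| = (q - d)%N by rewrite cardsD (setIidPr AB) cA cB.
have cC : #|~: (B :\: A)| = (n.+1 - (q - d))%N by rewrite cardsCs setCK cD card_ord.
rewrite (bigID (mem (B :\: A))) /= -cC -cD -!sumr_const; congr +%R.
  apply: eq_bigr => k; rewrite inE => /andP[/negPf kA kB].
  by have := statE k; rewrite kA kB addn0 addn1 => ->.
apply: eq_big => [k|k]; first by rewrite !inE.
have := statE k; have /implyP := subsetP AB k; rewrite inE.
by case: (k \in A); case: (k \in B) => //= _ /eqP; rewrite ?eqn_add2r ?addn0 => /eqP->.
Qed.

Lemma card_ord_lt n q : (q <= n)%N -> #|[set i : 'I_n | (i < q)%N]| = q.
Proof.
move=> qn; rewrite cardsE -sum1_card (eq_bigl (fun i : 'I_n => (i < q)%N)) //.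
by rewrite -(big_ord_widen _ (fun=> 1%N) qn) sum1_card card_ord.
Qed.

Lemma perm_insert_bij n (g : 'I_n.+1 -> 'S_n -> 'S_n.+1) :
  (forall k l u v, g k u = g l v -> k = l /\ u = v) ->
  bijective (fun ku : 'I_n.+1 * 'S_n => g ku.1 ku.2).
Proof.
move=> inj_g; apply/inj_card_bij => [[k u] [l v] /= /inj_g[-> ->]//|].
by rewrite card_prod !card_Sn card_ord factS.
Qed.

Lemma sum_perm_insert (V : nmodType) n (F : 'S_n.+1 -> V)
    (g : 'I_n.+1 -> 'S_n -> 'S_n.+1) :
  (forall k l u v, g k u = g l v -> k = l /\ u = v) ->
  \sum_w F w = \sum_u \sum_k F (g k u).
Proof.
move=> /perm_insert_bij g_bij; rewrite exchange_big pair_big /=.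
by rewrite (reindex (fun ku : 'I_n.+1 * 'S_n => g ku.1 ku.2)) //=; exact: onW_bij.
Qed.

Lemma lift_perm_inj n (l : 'I_n.+1) k k' (u u' : 'S_n) :
  lift_perm k l u = lift_perm k' l u' -> k = k' /\ u = u'.
Proof.
move=> E; have kk : k = k'.
  by apply: (@perm_inj _ (lift_perm k l u)); rewrite {2}E !lift_perm_id.
split=> //; apply/permP => i; apply: (@lift_inj _ l).
by rewrite -!(lift_perm_lift k) E kk.
Qed.

(** The position of the largest value recovers k. *)
Lemma tperm_lift_perm_inj n k k' (u u' : 'S_n) :
  (tperm k ord_max * lift_perm ord_max ord_max u =
   tperm k' ord_max * lift_perm ord_max ord_max u')%g -> k = k' /\ u = u'.
Proof.
move=> E; have kk : k = k'.
  have := congr1 (fun w : 'S_n.+1 => w^-1%g ord_max) E.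
  rewrite !invMg !permM !lift_permV !lift_perm_id !tpermV.
  by rewrite !tpermR.
by move: E; rewrite kk => /mulgI/lift_perm_inj[].
Qed.

(** * The recursion for each statistic *)

Section LastCar.

Variables (n : nat) (b : n.+1.-tuple nat).
Hypothesis b_mono : forall i j : 'I_n.+1, (i <= j)%N -> (tnth b i <= tnth b j)%N.
Let b0 : n.-tuple nat := [tuple tnth b (lift ord_max i) | i < n].

Variable q : nat.
Hypotheses (qn : (q <= n)%N) (b_max : tnth b ord_max = q.+1).

Lemma rearrange_le (u : 'S_n) i : (tnth (rearrange b0 u) i <= q.+1)%N.
Proof. by rewrite !tnth_mktuple -b_max b_mono // leq_ord. Qed.

Lemma exced_insert (V : nmodType) (F : nat -> V) (u : 'S_n)
    (d := exced (rearrange b0 u)) :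
  \sum_k F (exced (rearrange b (tperm k ord_max * lift_perm ord_max ord_max u)%g))
   = F d.+1 *+ (q - d) + F d *+ (n.+1 - (q - d)).
Proof.
set E := [set i : 'I_n | (i.+1 < tnth (rearrange b0 u) i)%N].
apply: (@sum_insertions _ F n q d [set lift ord_max i | i in E]
  [set k : 'I_n.+1 | (k < q)%N]
  (fun k => exced (rearrange b (tperm k ord_max * lift_perm ord_max ord_max u)%g))).
- apply/subsetP => k /imsetP[i]; rewrite !inE => iE ->.
  by have := rearrange_le u i; rewrite /= /bump; have := ltn_ord i; lia.
- by rewrite card_imset //; exact: lift_inj.
- by rewrite card_ord_lt // ltnW.
have excedE m (p : m.-tuple nat) : exced p = (\sum_(i < m) (i.+1 < tnth p i))%N.
  by rewrite /exced cardsE -sum1_card big_mkcond.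
move=> k; rewrite /d !excedE (bigD1_ord ord_max) //= tnth_mktuple permM tpermR.
(* The last position is never an excedance, whichever preference was moved there. *)
have b_lt i : (n.+1 < tnth b i)%N = false.
  by apply/negP; have := @b_mono i ord_max (leq_ord _); rewrite b_max; lia.
rewrite b_lt add0n.
have termE i : lift ord_max i != k ->
    tnth (rearrange b (tperm k ord_max * lift_perm ord_max ord_max u)%g)
      (lift ord_max i) = tnth (rearrange b0 u) i.
  move=> ik; rewrite !tnth_mktuple permM tpermD ?neq_lift //.
    by rewrite lift_perm_lift.
  by rewrite eq_sym.
have bump_max (i : 'I_n) : bump n i = i := lift_max i.
case: (unliftP ord_max k) => [i0|] kE.
  rewrite (bigD1 i0) //= [in RHS](bigD1 i0) //= kE mem_imset; last exact: lift_inj.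
  rewrite tnth_mktuple permM -kE tpermL lift_perm_id b_max !inE kE lift_max bump_max ltnS.
  rewrite -addnA [RHS]addnC; congr addn.
  rewrite [LHS]addnC; congr addn.
  apply: eq_bigr => i ii0; rewrite bump_max -kE termE // kE.
  by rewrite (inj_eq lift_inj).
have -> : (k \in [set lift ord_max i | i in E]) = false.
  by apply/imsetP => -[i _ ki]; have := neq_lift ord_max i; rewrite -ki kE eqxx.
have -> : (k \in [set i : 'I_n.+1 | (i < q)%N]) = false by rewrite inE kE /=; lia.
rewrite !addn0; apply: eq_bigr => i _.
by rewrite bump_max termE // kE eq_sym neq_lift.
Qed.

Lemma des_insert (V : nmodType) (F : nat -> V) (u s : 'S_n) (d := des s) :
  parks (rearrange b0 u) s ->
  \sum_k F (des (outcome (rearrange b (lift_perm k ord_max u))))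
   = F d.+1 *+ (q - d) + F d *+ (n.+1 - (q - d)).
Proof.
move=> sP.
apply: (@sum_insertions _ F n q d [set lift ord0 i | i in descent s]
  [set lift ord_max j | j in [set j : 'I_n | (s j < q)%N]]
  (fun k => des (outcome (rearrange b (lift_perm k ord_max u))))).
- apply/subsetP => _ /imsetP[i /existsP[j /andP[/eqP ji sji]] ->].
  apply/imsetP; exists j; last by apply/val_inj; rewrite /= /bump; have := ltn_ord j; lia.
  (* Beyond spot q the outcome increases with arrival, so a descent ends at a spot at most q. *)
  rewrite inE ltnNge; apply/negP => qj.
  by have := parks_increasing sP (rearrange_le u) qj sji; lia.
- by rewrite card_imset /d /des ?cardsE //; exact: lift_inj.
- rewrite card_imset; last exact: lift_inj.
  rewrite -[RHS](card_ord_lt qn) -[RHS](card_preimset _ (@perm_inj _ s)).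
  by apply: eq_card => i; rewrite !inE.
move=> k.
have p'k : tnth (rearrange b (lift_perm k ord_max u)) k = q.+1.
  by rewrite tnth_mktuple lift_perm_id.
have p'l i : tnth (rearrange b (lift_perm k ord_max u)) (lift k i)
    = tnth (rearrange b0 u) i.
  by rewrite !tnth_mktuple lift_perm_lift.
have [v [qv vP]] := insertion_spot qn sP (rearrange_le u) k.
rewrite (outcome_parks (parks_lift qn sP (rearrange_le u) qv vP p'k p'l)).
exact: (des_lift qn qv vP).
Qed.

End LastCar.

(** * Induction on the length *)

Definition content_bounds n (b : n.-tuple nat) : Prop :=
  (forall i j : 'I_n, (i <= j)%N -> (tnth b i <= tnth b j)%N) /\
  (forall i : 'I_n, (0 < tnth b i <= i.+1)%N).

Lemma parking_content_bounds n (b : n.-tuple nat) :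
  parking_content b -> content_bounds b.
Proof.
case/andP=> sb /forallP bP; split=> // i j ij.
by rewrite !(tnth_nth 0%N) (sorted_leq_nth leq_trans leqnn) // inE size_tuple.
Qed.

Lemma content_bounds_belast n (b : n.+1.-tuple nat) :
  content_bounds b -> content_bounds [tuple tnth b (lift ord_max i) | i < n].
Proof.
case=> b_mono b_pos; split=> [i j ij|i]; rewrite !tnth_mktuple.
  by apply: b_mono; rewrite !lift_max.
by have := b_pos (lift ord_max i); rewrite lift_max.
Qed.

(** Every [w] arises by inserting the largest value into a shorter permutation, and [parks_lift]
    carries the outcome along. *)
Lemma parks_exists n (b : n.-tuple nat) (w : 'S_n) :
  content_bounds b -> exists s, parks (rearrange b w) s.
Proof.
elim: n b w => [|n IH] b w bP; first by exists 1%g => -[].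
have [g' _ gK] := perm_insert_bij (@lift_perm_inj n ord_max).
rewrite -(gK w); case: (g' w) => k u /=.
have [s sP] := IH _ u (content_bounds_belast bP).
have [b_mono b_pos] := bP.
have qn : ((tnth b ord_max).-1 <= n)%N by have := b_pos ord_max; rewrite /=; lia.
have b_max : tnth b ord_max = (tnth b ord_max).-1.+1 by have := b_pos ord_max; lia.
have le_q := rearrange_le b_mono b_max u.
have [v [qv vP]] := insertion_spot qn sP le_q k.
exists (lift_perm k v s); apply: (parks_lift qn sP le_q qv vP) => [|i].
  by rewrite tnth_mktuple lift_perm_id.
by rewrite !tnth_mktuple lift_perm_lift.
Qed.

(** An arbitrary weight [F] keeps the induction closed: the recursion turns [F] into another
    function of d, with multiplicities depending on d. *)
Lemma exced_des_equidistributed (V : nmodType) (F : nat -> V) n (b : n.-tuple nat) :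
  content_bounds b ->
  \sum_(w : 'S_n) F (exced (rearrange b w))
    = \sum_(w : 'S_n) F (des (outcome (rearrange b w))).
Proof.
elim: n b F => [|n IH] b F bP.
  have card0 (A : {set 'I_0}) : #|A| = 0%N.
    by apply: eq_card0 => -[].
  by apply: eq_bigr => w _; rewrite /exced /des !card0.
have bP0 := content_bounds_belast bP; have [b_mono b_pos] := bP.
pose q := (tnth b ord_max).-1.
have qn : (q <= n)%N by have := b_pos ord_max; rewrite /= /q; lia.
have b_max : tnth b ord_max = q.+1 by have := b_pos ord_max; rewrite /q; lia.
rewrite (sum_perm_insert _ (@tperm_lift_perm_inj n)).
rewrite (sum_perm_insert _ (@lift_perm_inj n ord_max)).
under eq_bigr do rewrite (exced_insert b_mono qn b_max).
rewrite (IH _ (fun d => F d.+1 *+ (q - d) + F d *+ (n.+1 - (q - d)))) //.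
apply: eq_bigr => u _; have [s sP] := parks_exists u bP0.
by rewrite (des_insert b_mono qn b_max F sP) (outcome_parks sP).
Qed.

Theorem theorem3p1 (n : nat) (b : n.-tuple nat) :
  (0 < n)%N -> parking_content b ->
  \sum_(w : 'S_n) 'X^(exced (rearrange b w))
    = \sum_(w : 'S_n) 'X^(des (outcome (rearrange b w))) :> {poly int}.
Proof.
move=> _ /parking_content_bounds.
exact: (exced_des_equidistributed (fun d => 'X^d : {poly int})).
Qed.
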